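(* Let $X$ be a real Banach space and let $f_0, f_k : X\to\mathbb{R}\cup\{+\infty\}$ ($k\ge 1$) be proper convex functions. Let $(\mathcal P)$ be the problem $\inf\{f_0(x) : x\in X,\ f_k(x)\le 0\ \forall k\ge 1\}$, with optimal value $v(\mathcal P)<+\infty$, and put $f:=\sup_{k\ge1}f_k$. Assume the reinforced Slater condition: there exist $x_0\in\operatorname{dom}f_0$ and $(\alpha_k)_k\in\ell_1$ with $\alpha_k>0$ for all $k\ge1$ such that $$\sup_{k\ge1}\alpha_kf_k(x_0)<0.$$ If $f$ is continuous at some point in $\operatorname{dom}f_0$, then $v(\mathcal P_3^{**})=v(\mathcal P)$, where $(\mathcal P_3^{**})$ is the problem $$\inf\Big\{f_0^{**}(z): z\in X^{**},\ f_k^{**}(z)\le0\ \forall k\ge1,\ z\in\overline{\operatorname{dom}f^{**}}^{w^{**}}\Big\}.$$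
   Context: $X^*$ and $X^{**}$ are the dual and bidual of $X$, with $X\subset X^{**}$ canonically. $\operatorname{dom}h:=\{h<+\infty\}$. For $h:X\to\overline{\mathbb R}$: $h^*(x^* ):=\sup_{x\in X}(\langle x^*,x\rangle-h(x))$ for $x^*\in X^*$, and $h^{**}(z):=\sup_{x^*\in X^*}(\langle z,x^*\rangle-h^*(x^* ))$ for $z\in X^{**}$. $\overline{A}^{w^{**}}$ is the closure of $A\subset X^{**}$ in the weak-* topology $w^{**}=\sigma(X^{**},X^* )$. $\ell_1$ is the space of absolutely summable real sequences. $v(\cdot)$ denotes the optimal value of a minimization problem, equal to $+\infty$ if it is infeasible. *)

(* Defs.v *)
From HB Require Import structures.
From mathcomp Require Import all_boot all_order all_algebra.
From mathcomp Require Import all_classical all_reals all_analysis.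

Set Implicit Arguments.
Unset Strict Implicit.
Unset Printing Implicit Defensive.

Import Order.TTheory GRing.Theory Num.Theory.
Import numFieldNormedType.Exports.

Local Open Scope classical_set_scope.
Local Open Scope ring_scope.

Section dual_space.
Context {R : realType} (X : normedModType R).

Definition dual_pred : {pred X -> R^o} :=
  [pred l : X -> R^o | `[< linear l /\ continuous l >]].

Lemma dual_predP (l : X -> R^o) :
  reflect (linear l /\ continuous l) (l \in dual_pred).
Proof. by rewrite unfold_in; apply/asboolP. Qed.

Lemma dual_submod_closed : submod_closed dual_pred.
Proof.
split; first by apply/dual_predP; split;
  [move=> a x y; rewrite /= addr0 scaler0|exact: cst_continuous].
move=> a l m /dual_predP[lL lC] /dual_predP[mL mC]; apply/dual_predP; split.
  by move=> b x y; rewrite !fctE lL mL !scalerDr !scalerA [a * b]mulrC addrACA.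
by move=> x; apply: cvgD; [apply: cvgZr; exact: lC|exact: mC].
Qed.

HB.instance Definition _ :=
  GRing.isSubmodClosed.Build R (X -> R^o) dual_pred dual_submod_closed.

Record dual : Type := Dual { dual_fun :> X -> R^o ; _ : dual_fun \in dual_pred }.

HB.instance Definition _ := [isSub for dual_fun].
HB.instance Definition _ := [Choice of dual by <:].
HB.instance Definition _ := [SubChoice_isSubLmodule of dual by <:].

Lemma dualE (a : R) (l m : dual) x : (a *: l + m) x = a * l x + m x.
Proof. by []. Qed.

Lemma dual_linear (l : dual) : linear l.
Proof. by case: l => l /= /dual_predP[]. Qed.

Lemma dual_continuous (l : dual) : continuous l.
Proof. by case: l => l /= /dual_predP[]. Qed.

HB.instance Definition _ (l : dual) :=
  GRing.isLinear.Build R X R^o *:%R l (dual_linear l).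

Definition dual_norm (l : dual) : R :=
  sup [set `|l x| | x in [set x : X | `|x| <= 1]].

Lemma dual_norm_has_sup (l : dual) :
  has_sup [set `|l x| | x in [set x : X | `|x| <= 1]].
Proof.
split; first by exists `|l 0|, 0 => //=; rewrite normr0.
have /linear_bounded_continuous/linear_boundedP := @dual_continuous l.
move=> /pinfty_ex_gt0[r r0 lr]; exists r => _ [x /= x1 <-].
by rewrite (le_trans (lr x))// ler_piMr// ltW.
Qed.

Lemma dual_norm_ub (l : dual) x : `|x| <= 1 -> `|l x| <= dual_norm l.
Proof.
move=> x1; apply: sup_upper_bound; first exact: dual_norm_has_sup.
by exists x.
Qed.

Lemma dual_norm_le (l : dual) r :
  (forall x, `|x| <= 1 -> `|l x| <= r) -> dual_norm l <= r.
Proof.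
move=> lr; apply: ge_sup; first exact: (dual_norm_has_sup l).1.
by move=> _ [x /= x1 <-]; exact: lr.
Qed.

Lemma dual_norm_ge0 (l : dual) : 0 <= dual_norm l.
Proof. by rewrite (le_trans (normr_ge0 (l 0)))// dual_norm_ub// normr0. Qed.

Lemma ler_dual_normD (l m : dual) :
  dual_norm (l + m) <= dual_norm l + dual_norm m.
Proof.
apply: dual_norm_le => x x1.
by rewrite (le_trans (ler_normD _ _))// lerD// dual_norm_ub.
Qed.

Lemma dual_normZ (a : R) (l : dual) : dual_norm (a *: l) = `|a| * dual_norm l.
Proof.
have le_normZ b m : dual_norm (b *: m) <= `|b| * dual_norm m.
  apply: dual_norm_le => x x1.
  have -> : (b *: m) x = b * m x by [].
  by rewrite normrM ler_wpM2l// dual_norm_ub.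
apply/eqP; rewrite eq_le le_normZ /=.
have [->|a0] := eqVneq a 0; first by rewrite normr0 mul0r dual_norm_ge0.
rewrite -ler_pdivlMl ?normr_gt0// -normfV.
by have := le_normZ a^-1 (a *: l); rewrite scalerA mulVf// scale1r.
Qed.

Lemma dual_norm0_eq0 (l : dual) : dual_norm l = 0 -> l = 0.
Proof.
move=> l0; apply/val_inj/funext => x /=.
have [->|x0] := eqVneq x 0; first by rewrite linear0.
have nx0 : `|x| != 0 by rewrite normr_eq0.
have : `|l (`|x|^-1 *: x)| <= dual_norm l.
  by apply: dual_norm_ub; rewrite normrZ normfV normr_id mulVf.
rewrite l0 normr_le0 linearZ /= => /eqP/(congr1 ( *%R `|x|)).
by rewrite mulr0 [_ *: _]/GRing.scale /= mulVKf.
Qed.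

HB.instance Definition _ := Lmodule_isNormed.Build R dual
  ler_dual_normD dual_normZ dual_norm0_eq0.

End dual_space.

(* [dual Y] with the topology sigma(Y^*, Y) of pointwise convergence on Y *)
Definition weak_star {R : realType} (Y : normedModType R) : Type :=
  initial_topology ((fun l : dual Y => (l : Y -> R)) : dual Y -> {ptws Y -> R}).

HB.instance Definition _ {R : realType} (Y : normedModType R) :=
  Topological.on (weak_star Y).

Lemma weak_star_cvgP {R : realType} (Y : normedModType R)
    (F : set_system (dual Y)) (l : dual Y) : Filter F ->
  F --> (l : weak_star Y) <-> forall y, (m : dual Y) y @[m --> F] --> l y.
Proof.
move=> FF; have -> : (F --> (l : weak_star Y)) <->
    {ptws, (fun m : dual Y => (m : Y -> R)) @ F --> (l : Y -> R)}.
  split=> [Fl|Fl].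
    apply: cvg_trans (@initial_continuous _ {ptws Y -> R}
      (fun m : dual Y => (m : Y -> R)) (l : weak_star Y)).
    exact: cvg_app.
  move=> A [_ [[B oB <-] Bl BA]].
  by apply: filterS BA _; apply: Fl; exact: open_nbhs_nbhs.
exact: pointwise_cvgP.
Qed.

Definition weak_star_closure {R : realType} {Y : normedModType R}
  (A : set (dual Y)) : set (dual Y) := closure (A : set (weak_star Y)).

Section extended_real_functions.
Context {R : realType} {X : normedModType R}.
Implicit Type h : X -> \bar R.

Local Open Scope ereal_scope.

Definition edom h : set X := [set x | h x < +oo].

Definition eproper h : Prop := (forall x, h x != -oo) /\ edom h !=set0.

(* Meant for h > -oo. Since 0 * +oo = 0, the endpoints t = 0 and t = 1 impose
   nothing, even at points where h is infinite. *)
Definition econvex h : Prop :=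
  forall (x y : X) (t : R), (0 <= t <= 1)%R ->
    h (t *: x + (1 - t) *: y)%R <= t%:E * h x + (1 - t)%:E * h y.

Definition conjugate h (l : dual X) : \bar R :=
  ereal_sup [set (l x)%:E - h x | x in [set: X]].

(* optimal value of "minimize h over D"; it is +oo when D is empty *)
Definition optval h (D : set X) : \bar R := ereal_inf [set h x | x in D].

End extended_real_functions.

(* The conjugate of a function on [dual X] is a function on [dual (dual X)]. *)
Definition biconjugate {R : realType} {X : normedModType R} (h : X -> \bar R) :
  dual (dual X) -> \bar R := conjugate (conjugate h).

(* Main.v *)
Require Import Defs.
From HB Require Import structures.
From mathcomp Require Import all_boot all_order all_algebra.
From mathcomp Require Import all_classical all_reals all_analysis.
From mathcomp Require Import ring lra.

(* A convex combination of the Slater point with the continuity point is the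
   centre [x0] of a ball on which every [f_k], [k >= 1], is negative, while
   [f_k x0] tends to [-oo] because [alpha_k -> 0].

   Let [v] be the optimal value, assumed finite.  By Hahn-Banach there is a
   continuous affine [A_0 <= f_0] with [A_0 >= v] on
   [C_0 = {f_k <= 0 for all k >= 1}].  Constraints are then removed one at a
   time: given [A_n >= v] on [C_n = {f_k <= 0 for all k > n}], Hahn-Banach gives
   [A_{n+1} >= v] on [C_{n+1}] with [A_{n+1} <= A_n] on [{f_{n+1} <= 0}].  Since
   that sublevel set contains the ball, [A_n - A_{n+1}] has norm controlled by its
   value at [x0], and these values telescope because [A_n x0 >= v]; hence [A_n]
   converges in norm to some [A].

   If [x] is in [dom f], then [t x0 + (1 - t) x] lies in [C_n] for [n] large, as
   [f_k x0 -> -oo] and [f_k x] is bounded above in [k].  So [A >= v] on [dom f],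
   then on [dom f**] and on its weak-star closure.  Finally [f_k** z <= 0] forces
   [A_k z <= A_{k-1} z], so [f_0** z >= A_0 z >= A z >= v]. *)

Set Implicit Arguments.
Unset Strict Implicit.
Unset Printing Implicit Defensive.

Import Order.TTheory GRing.Theory Num.Theory.
Import numFieldNormedType.Exports.

Local Open Scope classical_set_scope.
Local Open Scope ring_scope.

(** * Hahn-Banach extension by Zorn's lemma *)

Section riesz_extension.
Context {R : realType} {V : lmodType R}.
(* [K x s] reads [p x <= s] for a sublinear [p], which need not be formed. *)
Variable K : V -> R -> Prop.
Hypothesis K_add : forall x y s t, K x s -> K y t -> K (x + y) (s + t).
Hypothesis K_scale : forall a x s, 0 < a -> K x s -> K (a *: x) (a * s).
Hypothesis K_total : forall x, exists s, K x s.
Hypothesis K_ge0 : forall s, K 0 s -> 0 <= s.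

(** Dominated partial linear functionals, encoded by their graphs. The empty set qualifies, as the
    union of an empty chain must; that graphs are single-valued is recovered from domination in
    [riesz_extension]. *)
Definition linear_graph_below (G : set (V * R)) : Prop :=
  (forall a u v, G u -> G v -> G (a *: u.1 + v.1, a * u.2 + v.2)) /\
  (forall u s, G u -> K u.1 s -> u.2 <= s).

Lemma linear_graph_belowD_line G y : G !=set0 -> linear_graph_below G ->
  exists r, linear_graph_below
    [set u | exists x t, G x /\ u = (x.1 + t *: y, x.2 + t * r)].
Proof.
move=> [g0 Gg0] [Glin GK].
have G0 : G (0, 0).
  have := Glin (-1) _ _ Gg0 Gg0.
  by rewrite scaleN1r addNr mulN1r addNr.
have GZ a u : G u -> G (a *: u.1, a * u.2).
  by move=> Gu; have := Glin a _ _ Gu G0; rewrite /= !addr0.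
have GD u v : G u -> G v -> G (u.1 + v.1, u.2 + v.2).
  by move=> Gu Gv; have := Glin 1 _ _ Gu Gv; rewrite scale1r mul1r.
(* [L] collects the lower bounds that domination at [x.1 - y] puts on the value at [y]. By [K_add]
   they lie below all upper bounds coming from [x'.1 + y], so [sup L] is admissible. Other multiples
   of [y] reduce to these two by rescaling with the inverse of [t]. *)
pose L := [set q | exists x s, [/\ G x, K (x.1 - y) s & q = x.2 - s]].
have Lle x s x' s' : G x -> K (x.1 - y) s -> G x' -> K (x'.1 + y) s' ->
    x.2 - s <= s' - x'.2.
  move=> Gx Kx Gx' Kx'; rewrite lerBrDr addrAC lerBlDr.
  apply: (GK _ _ (GD _ _ Gx Gx')) => /=.
  by have := K_add Kx' Kx; rewrite addrA addrAC addrK [x'.1 + _]addrC.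
have [s1 Ks1] := K_total (0 + y).
have hL : has_sup L.
  split; last by exists (s1 - 0) => _ [x [s [Gx Kx ->]]]; exact: (Lle _ _ (0, 0)).
  have [s2 Ks2] := K_total (0 - y).
  by exists (0 - s2), (0, 0), s2.
exists (sup L); split.
  move=> a _ _ [x [t [Gx ->]]] [x' [t' [Gx' ->]]] /=.
  exists (a *: x.1 + x'.1, a * x.2 + x'.2), (a * t + t').
  split; first exact: Glin.
  rewrite /=; congr pair; last by ring.
  by rewrite scalerDr scalerDl scalerA !addrA; congr (_ + _); rewrite addrAC.
move=> _ s [x [t [Gx ->]]] /=.
have [t0|t0|->] := ltgtP t 0.
- have t'0 : 0 < - t^-1 by rewrite oppr_gt0 invr_lt0.
  move=> /(K_scale t'0); rewrite scalerDr scalerA mulNr mulVf ?lt_eqF// scaleN1r.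
  move=> Ks.
  have : L (- t^-1 * x.2 - - t^-1 * s).
    by eexists _, _; split; [exact: (GZ (- t^-1) _ Gx)| exact: Ks|].
  move=> /(sup_upper_bound hL).
  by rewrite -mulrBr mulNr -mulrN ler_ndivrMl// opprB; lra.
- move=> Ks; have t'0 : 0 < t^-1 by rewrite invr_gt0.
  move: Ks => /(K_scale t'0).
  rewrite scalerDr scalerA mulVf ?gt_eqF// scale1r => Ks.
  have : sup L <= t^-1 * s - t^-1 * x.2.
    apply: ge_sup; first exact: hL.1.
    by move=> _ [x' [s' [Gx' Kx' ->]]]; exact: (Lle _ _ _ _ Gx' Kx' (GZ t^-1 _ Gx)).
  by rewrite -mulrBr ler_pdivlMl//; lra.
- by rewrite scale0r mul0r !addr0; exact: GK.
Qed.

Lemma riesz_extension : exists l : V -> R,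
  linear (l : V -> R^o) /\ forall x s, K x s -> l x <= s.
Proof.
have chain (F : set (set (V * R))) : F `<=` linear_graph_below ->
    total_on F subset -> linear_graph_below (\bigcup_(G in F) G).
  move=> FP Ftot; split; last first.
    by move=> u s [G FG Gu]; exact: (FP _ FG).2.
  move=> a u v [G FG Gu] [G' FG' Gv].
  have [GG'|G'G] := Ftot _ _ FG FG'.
    by exists G' => //; apply: (FP _ FG').1 => //; exact: GG'.
  by exists G => //; apply: (FP _ FG).1 => //; exact: G'G.
have [G [[Glin GK] Gmax]] := Zorn_bigcup chain.
have G_n0 : G !=set0.
  (* The empty graph is not maximal: the zero functional on the zero subspace extends it. *)
  apply/set0P/negP => /eqP G0; apply: (Gmax [set (0, 0)]).
    by rewrite G0; split=> [u//|/(_ (0, 0) erefl)].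
  split; first by move=> a _ _ -> ->; rewrite /= scaler0 mulr0 !addr0.
  by move=> _ s -> /=; exact: K_ge0.
have Gtot y : exists r, G (y, r).
  have [r Hr] := linear_graph_belowD_line y G_n0 (conj Glin GK).
  exists r; apply: contrapT => nG.
  have [g Gg] := G_n0.
  apply: Gmax Hr; split=> [|/(_ (y, r)) BG]; last first.
    apply/nG/BG.
    exists (0, 0), 1; split; last by rewrite /= scale1r mul1r !add0r.
    by have := Glin (-1) _ _ Gg Gg; rewrite scaleN1r addNr mulN1r addNr.
  move=> u Gu; exists u, 0; split=> //.
  by rewrite scale0r mul0r !addr0; case: u Gu.
have Guniq y r r' : G (y, r) -> G (y, r') -> r = r'.
  move=> Gr Gr'; apply/eqP; rewrite -subr_eq0; apply/negP => /negP d0.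
  have Gd : G (0, r - r').
    have := Glin (-1) _ _ Gr' Gr.
    by rewrite /= scaleN1r addNr mulN1r addrC.
  have [s Ks] := K_total 0.
  (* The scalar is chosen so that the combination is [(0, s + 1)], against [K 0 s]. *)
  have := Glin ((s + 1) / (r - r') - 1) _ _ Gd Gd.
  move=> /GK /= /(_ s); rewrite scaler0 addr0 => /(_ Ks).
  by rewrite mulrBl divfK// mul1r subrK gerDl ler10.
have [l Gl] := choice Gtot.
exists l; split; last by move=> x s; exact: GK (Gl x).
by move=> a x y; apply: (Guniq (a *: x + y)) => //; exact: Glin (Gl x) (Gl y).
Qed.

End riesz_extension.

(** * Separation by continuous affine functions *)

Definition convex {R : realType} {V : lmodType R} (C : set V) : Prop :=
  forall x y t, 0 <= t <= 1 -> C x -> C y -> C (t *: x + (1 - t) *: y).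

Lemma dual_of_bounded {R : realType} {X : normedModType R} (l : X -> R^o) :
  linear l -> (forall r, exists M : R, forall x, `|x| <= r -> `|l x| <= M) ->
  exists L : dual X, forall x, L x = l x.
Proof.
move=> llin lbnd.
pose lL := GRing.isLinear.Build R X R^o *:%R l llin.
pose L : {linear X -> R^o} := HB.pack (l : X -> R^o) lL.
have Lcont : continuous L.
  by apply: bounded_linear_continuous; apply/bounded_funP; exact: lbnd.
have lP : l \in @dual_pred R X by apply/dual_predP.
by exists (Dual lP).
Qed.

(** [E] stands for the epigraph of a convex function. A linear functional dominated by the cone [K]
    below satisfies [l x - s <= l w - v] for [E x s] and [C w], and [b] is read off from the gap.
    The ball inside [C] makes [K] total and the functional continuous. *)
Lemma affine_sandwich {R : realType} {X : normedModType R}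
    (E : X -> R -> Prop) (C : set X) x0 s0 v rho :
  (forall x y s r t, 0 <= t <= 1 -> E x s -> E y r ->
    E (t *: x + (1 - t) *: y) (t * s + (1 - t) * r)) ->
  convex C -> 0 < rho -> (forall x, `|x - x0| < rho -> C x) -> E x0 s0 ->
  (forall x s, E x s -> C x -> v <= s) ->
  exists (l : dual X) (b : R),
    (forall x s, E x s -> l x + b <= s) /\ (forall x, C x -> v <= l x + b).
Proof.
move=> Ecvx Ccvx rho0 Cball Ex0 ECv.
(* The cone generated by the differences [E - C * {v}]. *)
pose K u r := exists a x s w,
  [/\ 0 < a, E x s, C w, u = a *: (x - w) & r = a * (s - v)].
have convE (a b : R) : 0 < a -> 0 < b ->
    0 <= a / (a + b) <= 1 /\ 1 - a / (a + b) = b / (a + b).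
  move=> a0 b0; have ab0 : 0 < a + b by rewrite addr_gt0.
  split.
    by rewrite divr_ge0 ?(ltW a0) ?(ltW ab0)//= ler_pdivrMr// mul1r lerDl ltW.
  by rewrite -{1}(divff (lt0r_neq0 ab0)) -mulrBl addrAC subrr add0r.
have KD x y s t : K x s -> K y t -> K (x + y) (s + t).
  move=> [a [x1 [s1 [w1 [a0 E1 C1 -> ->]]]]] [b [x2 [s2 [w2 [b0 E2 C2 -> ->]]]]].
  have [ab01 abE] := convE _ _ a0 b0.
  have ab0 : a + b != 0 by rewrite gt_eqF// addr_gt0.
  eexists (a + b), _, _, _; split; first exact: addr_gt0.
  - exact: Ecvx ab01 E1 E2.
  - exact: Ccvx ab01 C1 C2.
  - rewrite abE opprD addrACA -!scalerBr [RHS]scalerDr !scalerA.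
    by rewrite ![_ * (_ / _)]mulrC !divfK.
  - by rewrite abE; field.
have KZ a x s : 0 < a -> K x s -> K (a *: x) (a * s).
  move=> a0 [b [x1 [s1 [w1 [b0 E1 C1 -> ->]]]]].
  exists (a * b), x1, s1, w1; split=> //; first exact: mulr_gt0.
    by rewrite scalerA.
  by rewrite mulrA.
(* [u] is [d / rho] times the difference between [x0] and a point of the ball. *)
have Kball (u : X) (d : R) : `|u| < d -> K u (d / rho * (s0 - v)).
  move=> ud; have d0 : 0 < d by exact: le_lt_trans ud.
  have c0 : 0 < d / rho by exact: divr_gt0.
  exists (d / rho), x0, s0, (x0 - (d / rho)^-1 *: u); split=> //.
    apply: Cball; rewrite addrAC subrr add0r normrN normrZ gtr0_norm ?invr_gt0//.
    by rewrite invf_div mulrAC ltr_pdivrMr// ltr_pM2l.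
  by rewrite opprB addrC subrK scalerA divff ?scale1r// gt_eqF.
have [|s|l [llin lK]] := riesz_extension KD KZ.
- by move=> u; exists ((`|u| + 1) / rho * (s0 - v)); apply: Kball; rewrite ltrDl.
- move=> [a [x [r [w [a0 Ex Cw]]]]] /esym/eqP.
  rewrite scaler_eq0 gt_eqF//= subr_eq0 => /eqP xw ->.
  by rewrite mulr_ge0 ?(ltW a0)// subr_ge0; apply: ECv Ex _; rewrite xw.
have l0 : l 0 = 0.
  by have := llin (-1) 0 0; rewrite scaler0 addr0 scaleN1r addNr.
have lN x : l (- x) = - l x.
  by have := llin (-1) x 0; rewrite addr0 l0 addr0 !scaleN1r.
have [|L LE] := dual_of_bounded llin.
  move=> r; exists ((r + 1) / rho * (s0 - v)) => x xr; rewrite ler_norml.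
  have xr1 : `|x| < r + 1 by rewrite (le_lt_trans xr)// ltrDl.
  rewrite lK ?andbT; last exact: Kball.
  by rewrite lerNl -lN lK//; apply: Kball; rewrite normrN.
have lEC x s w : E x s -> C w -> L x - s <= L w - v.
  move=> Ex Cw; have : L (x - w) <= s - v.
    by rewrite LE; apply: lK; exists 1, x, s, w; rewrite scale1r mul1r.
  by rewrite linearB /=; lra.
pose S := [set q | exists x s, E x s /\ q = L x - s].
have hS : has_sup S.
  split; first by exists (L x0 - s0), x0, s0.
  exists (L x0 - v) => _ [x [s [Ex ->]]]; apply: lEC => //.
  by apply: Cball; rewrite subrr normr0.
exists L, (- sup S); split.
  move=> x s Ex; have : L x - s <= sup S by apply: sup_upper_bound => //; exists x, s.
  lra.
move=> w Cw; have : sup S <= L w - v.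
  by apply: ge_sup; [exact: hS.1|move=> _ [x [s [Ex ->]]]; exact: lEC].
lra.
Qed.

(** The sandwich gives an affine [a] with [a <= l + b] on [C] and [a >= v] on [S]; then
    [l + b - a + v] has both properties. *)
Lemma affine_lower_bound_split {R : realType} {X : normedModType R}
    (C S : set X) (l : dual X) (b v rho : R) x0 :
  convex C -> convex S -> 0 < rho -> C x0 ->
  (forall x, `|x - x0| < rho -> S x) ->
  (forall x, C x -> S x -> v <= l x + b) ->
  exists (m : dual X) (c : R), (forall x, C x -> v <= m x + c) /\
    (forall x, S x -> m x + c <= l x + b).
Proof.
move=> Ccvx Scvx rho0 Cx0 Sball CSv.
have [|||||x s [Cx xs] Sx|m [c [mE mS]]] := @affine_sandwich _ _
    (fun x s => C x /\ l x + b <= s) S x0 (l x0 + b) v rho.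
- move=> x y s r t t01 [Cx xs] [Cy ys]; split; first exact: Ccvx.
  rewrite linearP linearZ /=.
  have -> : t *: (l x : R^o) + (1 - t) *: (l y : R^o) + b =
    t * (l x + b) + (1 - t) * (l y + b) :> R by rewrite /GRing.scale /=; ring.
  by rewrite lerD// ler_wpM2l//; lra.
- by [].
- by [].
- by [].
- by [].
- by apply: le_trans xs; exact: CSv.
have lmE x : (l - m) x = l x - m x by [].
exists (l - m), (v + b - c); split=> x; rewrite lmE.
  by move=> Cx; have := mE x (l x + b) (conj Cx (lexx _)); lra.
by move=> /mS; lra.
Qed.

(** * Norm convergence in the dual *)

Lemma ler_dual_norm_mul {R : realType} {X : normedModType R} (l : dual X) x :
  `|l x| <= `|l| * `|x|.
Proof.
have [->|x0] := eqVneq x 0; first by rewrite linear0 !normr0 mulr0.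
have nx0 : 0 < `|x| by rewrite normr_gt0.
have : `|l (`|x|^-1 *: x)| <= `|l|.
  by apply: dual_norm_ub; rewrite normrZ normfV normr_id mulVf ?gt_eqF.
by rewrite linearZ/= normrM normfV normr_id ler_pdivrMl// mulrC.
Qed.

(** For each [x] the sequence [L n x + W n * |x|] is nonincreasing and bounded below, which yields a
    pointwise limit. Monotonicity at [x] and at [- x] bounds the error by [(W n - w) * |x|], so the
    convergence is in norm. *)
Lemma dual_cvg_of_variation {R : realType} {X : normedModType R}
    (L : nat -> dual X) (W : nat -> R) (v : R) :
  (forall n, `|L n.+1 - L n| <= W n - W n.+1) -> (forall n, v <= W n) ->
  exists l : dual X, L n @[n --> \oo] --> l.
Proof.
move=> LW Wv.
have Wdec : nonincreasing_seq W.
  by apply/nonincreasing_seqP => n; rewrite -subr_ge0 (le_trans _ (LW n)).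
have Wlb : has_lbound (range W) by exists v => _ [n _ <-].
have Wcvg := nonincreasing_is_cvgn Wdec Wlb.
set w := limn W.
pose u (x : X) n := L n x + W n * `|x|.
have LWx n x : `|L n.+1 x - L n x| <= (W n - W n.+1) * `|x|.
  by rewrite (le_trans (ler_dual_norm_mul (L n.+1 - L n) x))// ler_wpM2r.
have udec x : nonincreasing_seq (u x).
  apply/nonincreasing_seqP => n; rewrite /u.
  have := LWx n x; rewrite ler_norml => /andP[_]; lra.
have ulb x n : L 0%N x - W 0%N * `|x| + 2 * (v * `|x|) <= u x n.
  have : v * `|x| <= W n * `|x| by rewrite ler_wpM2r.
  have := @udec (- x) 0%N n (leq0n n).
  by rewrite /u !linearN normrN /=; lra.
have ucvg x : cvgn (u x).
  by apply: nonincreasing_is_cvgn => //; eexists => _ [n _ <-]; exact: ulb.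
have uE x : L n x @[n --> \oo] --> (limn (u x) - w * `|x|).
  have -> : (fun n => L n x) = (fun n => u x n - W n * `|x|).
    by apply/funext => n; rewrite addrK.
  by apply: cvgB => //; apply: cvgMl.
pose l (x : X) : R^o := limn (u x) - w * `|x|.
have llin : linear l.
  move=> a x y; apply: (cvg_unique _ (uE (a *: x + y))) => //=.
  under eq_fun do rewrite linearP.
  by apply: cvgD; [apply: cvgZr; exact: uE|exact: uE].
have lN x : l (- x) = - l x.
  apply: (cvg_unique _ (uE (- x))) => //=.
  by under eq_fun do rewrite linearN; apply: cvgN; exact: uE.
have lL n x : `|L n x - l x| <= (W n - w) * `|x|.
  have := nonincreasing_cvgn_ge (udec x) (ucvg x) n.
  have := nonincreasing_cvgn_ge (udec (- x)) (ucvg (- x)) n.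
  have limE y : limn (u y) = l y + w * `|y| by rewrite subrK.
  by rewrite !limE lN /u linearN normrN /= ler_norml => *; apply/andP; split; lra.
have [|l' l'E] := dual_of_bounded llin.
  move=> r; exists ((`|L 0%N| + (W 0%N - w)) * r) => x xr.
  have Ww : 0 <= W 0%N - w.
    by rewrite subr_ge0; exact: nonincreasing_cvgn_ge.
  have : (`|L 0%N| + (W 0%N - w)) * `|x| <= (`|L 0%N| + (W 0%N - w)) * r.
    by rewrite ler_wpM2l// addr_ge0.
  apply: le_trans; rewrite -(subKr (L 0%N x) (l x)) mulrDl.
  by rewrite (le_trans (ler_normB _ _))// lerD// ler_dual_norm_mul.
exists l'; apply/cvgrPdist_lt => e e0.
have : \forall n \near \oo, `|w - W n| < e by move/cvgrPdist_lt : Wcvg; exact.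
apply: filterS => n; apply: le_lt_trans; rewrite distrC [leRHS]distrC.
have Ww : 0 <= W n - w by rewrite subr_ge0; exact: nonincreasing_cvgn_ge.
apply: dual_norm_le => x x1.
have -> : (L n - l') x = L n x - l x by rewrite -l'E.
by rewrite (le_trans (lL n x))// ger0_norm// ler_piMr.
Qed.

Local Open Scope ereal_scope.

(** * Affine minorants and biconjugates *)

Section biconjugate.
Context {R : realType} {X : normedModType R}.
Implicit Types (h : X -> \bar R) (l m : dual X) (b c : R) (z : dual (dual X)).

(** The minorant means [conjugate h l <= - b]. All later lower bounds on biconjugates rest on
    this. *)
Lemma biconjugate_ge_affine h l b z :
  (forall x, (l x + b)%:E <= h x) -> (z l + b)%:E <= biconjugate h z.
Proof.
move=> lh; apply: (@le_trans _ _ ((z l)%:E - conjugate h l)); last first.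
  by apply: ereal_sup_ubound; exists l.
have : conjugate h l <= (- b)%:E.
  apply: ge_ereal_sup => _ [x _ <-].
  have := lh x; case: (h x) => [r| |].
  - by rewrite -EFinB !lee_fin; lra.
  - by rewrite leNye.
  - by rewrite leeNy_eq.
case: (conjugate h l) => [r| |].
- by rewrite -EFinB !lee_fin; lra.
- by rewrite leye_eq.
- by rewrite leey.
Qed.

Lemma ex_evaluation (x : X) : exists z, forall l, z l = l x.
Proof.
apply: (@dual_of_bounded _ (dual X) (fun l => l x)) => [//|r].
exists (r * `|x|)%R => l lr.
by rewrite (le_trans (ler_dual_norm_mul l x))// ler_wpM2r.
Qed.

Lemma biconjugate_evaluation_le h x z :
  (forall l, z l = l x) -> biconjugate h z <= h x.
Proof.
move=> zx; apply: ge_ereal_sup => _ [l _ <-]; rewrite zx.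
have : (l x)%:E - h x <= conjugate h l by apply: ereal_sup_ubound; exists x.
case: (h x) => [r| |]; case: (conjugate h l) => [s| |] //; rewrite ?leey ?leNye//.
by rewrite -!EFinB !lee_fin; lra.
Qed.

(* Adding positive multiples of [l' + c] to an affine minorant of [h] yields
   affine minorants again. *)
Lemma le0_edom_biconjugate h l b l' c z :
  (forall x, (l x + b)%:E <= h x) ->
  (forall x, edom h x -> (l' x + c <= 0)%R) ->
  biconjugate h z < +oo -> (z l' + c <= 0)%R.
Proof.
move=> lh l'0 hz; rewrite leNgt; apply/negP => d0.
have := biconjugate_ge_affine z lh.
case hzE: (biconjugate h z) hz => [M| |] // _; rewrite lee_fin => zM.
(* With this [n] the minorant [n * (l' + c) + (l + b)] takes the value [M + 1] at [z]. *)
pose n := ((M - (z l + b) + 1) / (z l' + c))%R.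
have n0 : (0 <= n)%R by rewrite divr_ge0 ?(ltW d0)//; lra.
have /(biconjugate_ge_affine z) : forall x,
    ((n *: l' + l) x + (n * c + b))%:E <= h x.
  move=> x; rewrite dualE; case hxE: (h x) => [r| |].
  - have := lh x; have := l'0 x; rewrite /edom /= hxE ltry => /(_ isT) l'c.
    have : (n * (l' x + c) <= 0)%R by rewrite mulr_ge0_le0.
    by rewrite !lee_fin; lra.
  - by rewrite leey.
  - by have := lh x; rewrite hxE.
have zE : z (n *: l' + l)%R = (n * z l' + z l)%R by exact: dual_linear.
rewrite hzE lee_fin zE.
have : (n * (z l' + c) = M - (z l + b) + 1)%R by rewrite divfK// gt_eqF.
lra.
Qed.

Lemma econvex_epi h x y (s r t : R) : econvex h -> (0 <= t <= 1)%R ->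
  h x <= s%:E -> h y <= r%:E ->
  h (t *: x + (1 - t) *: y)%R <= (t * s + (1 - t) * r)%:E.
Proof.
move=> hcvx t01 hx hy; apply: le_trans (hcvx x y t t01) _.
by rewrite [leRHS]EFinD !EFinM leeD// lee_wpmul2l// lee_fin; lra.
Qed.

(** Reflecting [x] through [x0] inside the ball, convexity gives [2 * h x0 <= h x + B]. So [h] is at
    least [2 * h x0 - B] on the ball, and the sandwich applies with the ball as [C]. *)
Lemma ex_affine_minorant h x0 (rho B : R) : econvex h -> (forall x, h x != -oo) ->
  (0 < rho)%R -> (forall x, (`|x - x0| < rho)%R -> h x <= B%:E) ->
  exists l b, forall x, (l x + b)%:E <= h x.
Proof.
move=> hcvx hNoo rho0 hB.
have hx0B : h x0 <= B%:E by apply: hB; rewrite subrr normr0.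
case h0E: (h x0) (hx0B) (hNoo x0) => [g| |] // _ _.
have [|||||x s hx Cx|l [b [lh _]]] := @affine_sandwich _ _
    (fun x s => h x <= s%:E) [set x | `|x - x0| < rho]%R x0 g (2 * g - B)%R rho.
- by move=> x y s r t t01; exact: econvex_epi.
- move=> x y t t01 /= xb yb.
  have -> : (t *: x + (1 - t) *: y - x0 = t *: (x - x0) + (1 - t) *: (y - x0))%R.
    by rewrite !scalerBr addrACA -opprD -scalerDl [(t + (1 - t))%R]addrC subrK scale1r.
  rewrite (le_lt_trans (ler_normD _ _))// !normrZ !ger0_norm; [|lra..].
  have [-> //|t0] := eqVneq t 0%R; first by rewrite mul0r add0r subr0 mul1r.
  have t0' : (0 < t)%R by rewrite lt_neqAle eq_sym t0; case/andP: t01.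
  have : (t * `|x - x0| < t * rho)%R by rewrite ltr_pM2l.
  have : ((1 - t) * `|y - x0| <= (1 - t) * rho)%R.
    by rewrite ler_wpM2l ?(ltW yb)//; lra.
  lra.
- by [].
- by [].
- by rewrite h0E.
- pose y := (2%:R *: x0 - x)%R.
  have Cy : (`|y - x0| < rho)%R.
    by rewrite /y scaler_nat mulr2n addrAC addrK distrC.
  have := @econvex_epi h x y s B (2^-1) hcvx _ hx (hB _ Cy).
  have -> : (1 - 2^-1 = 2^-1 :> R)%R by lra.
  rewrite /y -scalerDr addrC subrK scalerA mulVf ?pnatr_eq0// scale1r h0E lee_fin.
  have h2 : (0 <= (2^-1 : R) <= 1)%R by lra.
  by move=> /(_ h2); lra.
exists l, b => x; case hxE: (h x) => [r| |]; rewrite ?leey//.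
  by rewrite lee_fin; apply: lh; rewrite hxE.
by have := hNoo x; rewrite hxE.
Qed.

(* Under Slater's condition [h x0 < 0] the inequality is a consequence of
   [l x + b <= theta * h x] for some multiplier [theta >= 0]; a vanishing
   multiplier is dealt with by [le0_edom_biconjugate]. *)
Lemma le0_sublevel_biconjugate h l b m c x0 z : econvex h ->
  (forall x, (m x + c)%:E <= h x) -> h x0 < 0 ->
  (forall x, h x <= 0 -> (l x + b <= 0)%R) ->
  biconjugate h z <= 0 -> (z l + b <= 0)%R.
Proof.
move=> hcvx mh hx0 l0 hz.
have hNoo x : h x != -oo by have := mh x; case: (h x).
(* The multiplier is [sup S]: points with [h > 0] bound it from below by their ratios, points with
   [h < 0] from above. *)
pose S := [set q : R | exists x r,
  [/\ h x = r%:E, (0 < r)%R, (0 < l x + b)%R & q = ((l x + b) / r)%R]].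
have key x r y s : h x = r%:E -> (0 < r)%R -> (0 < l x + b)%R ->
    h y = s%:E -> (s < 0)%R -> ((l x + b) / r <= (l y + b) / s)%R.
  move=> hx r0 lx hy s0.
  have rs0 : (0 < r - s)%R by lra.
  (* The weight at which [r] and [s] average to [0], so that the combination lies in the sublevel
     set of [h]. *)
  pose t := (- s / (r - s))%R.
  have tE : (1 - t = r / (r - s))%R by rewrite /t; field; rewrite gt_eqF.
  have t01 : (0 <= t <= 1)%R.
    by rewrite divr_ge0//= ?ler_pdivrMr//; lra.
  have := @econvex_epi h x y r s t hcvx t01; rewrite hx hy !lexx => /(_ isT isT).
  have -> : (t * r + (1 - t) * s = 0)%R by rewrite tE /t; field; rewrite gt_eqF.
  move=> /l0; rewrite linearP linearZ /=.
  have -> : (t *: (l x : R^o) + (1 - t) *: (l y : R^o) + b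
    = (- s * (l x + b) + r * (l y + b)) / (r - s) :> R)%R.
    by rewrite tE /t /GRing.scale /=; field; rewrite gt_eqF.
  rewrite pmulr_lle0 ?invr_gt0// => le0.
  rewrite ler_pdivrMr// mulrAC ler_ndivlMr//; lra.
(* If [S] is empty, then [l + b <= 0] on all of [edom h]: this is the vanishing multiplier. *)
have [[q0 Sq0]|S0] := pselect (S !=set0); last first.
  apply: (le0_edom_biconjugate mh _ (le_lt_trans hz (ltry 0))) => x; rewrite /edom/= => hx.
  case hxE: (h x) hx (hNoo x) => [r| |] // _ _.
  have [r0|r0] := leP r 0%R; first by apply: l0; rewrite hxE lee_fin.
  by rewrite leNgt; apply/negP => lx; apply: S0; exists ((l x + b) / r)%R, x, r.
case h0E: (h x0) hx0 (hNoo x0) => [s0| |] //; rewrite lte_fin => s00 _.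
have hS : has_sup S.
  split; first by exists q0.
  by exists ((l x0 + b) / s0)%R => _ [x [r [hx r0 lx ->]]]; exact: key.
have theta0 : (0 < sup S)%R.
  apply: (@lt_le_trans _ _ q0); last exact: sup_upper_bound.
  by case: Sq0 => x [r [_ r0 lx ->]]; rewrite divr_gt0.
have /(biconjugate_ge_affine z) : forall x,
    (((sup S)^-1 *: l) x + (sup S)^-1 * b)%:E <= h x.
  move=> x; have -> : (((sup S)^-1 *: l) x + (sup S)^-1 * b =
    (l x + b) / sup S)%R.
    by rewrite [RHS]mulrC mulrDr.
  case hxE: (h x) (hNoo x) => [r| |] // _; last by rewrite leey.
  rewrite lee_fin ler_pdivrMr// mulrC.
  have [r0|r0|r0] := ltgtP r 0%R.
  - have : (sup S <= (l x + b) / r)%R.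
      apply: ge_sup; first exact: hS.1.
      by move=> _ [y [s [hy s'0 ly ->]]]; exact: key.
    by rewrite ler_ndivlMr.
  - have [lx|lx] := leP (l x + b)%R 0%R.
      by apply: (le_trans lx); rewrite mulr_ge0// ltW.
    rewrite -ler_pdivrMr//; apply: sup_upper_bound => //.
    by exists x, r.
  - by rewrite r0 mulr0; apply: l0; rewrite hxE r0.
move=> /le_trans /(_ hz); rewrite lee_fin linearZ /=.
have -> : ((sup S)^-1 *: (z l : R^o) = (sup S)^-1 * z l)%R by [].
by rewrite -mulrDr pmulr_rle0// invr_gt0.
Qed.

End biconjugate.

(** * Removing countably many constraints *)

Section countable_constraints.
Context {R : realType} {X : normedModType R}.
Variables (f : nat -> X -> \bar R) (x0 : X) (rho v : R) (z : dual (dual X)).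

Hypothesis f_Noo : forall k x, f k x != -oo.
Hypothesis f_convex : forall k, econvex (f k).
Hypothesis rho_gt0 : (0 < rho)%R.
Hypothesis f0_x0 : f 0%N x0 < +oo.
Hypothesis f_ball : forall k x, (0 < k)%N -> (`|x - x0| < rho)%R -> f k x < 0.
Hypothesis f_x0 : forall M : R, exists N, forall k, (N < k)%N -> f k x0 <= (- M)%:E.
Hypothesis f0_ge : forall x, (forall k, (0 < k)%N -> f k x <= 0) -> v%:E <= f 0%N x.
Hypothesis fz : forall k, (0 < k)%N -> biconjugate (f k) z <= 0.

Let S k := [set x | f k x <= 0].
Let C n := [set x | forall k, (n < k)%N -> S k x].

Let Scvx k : convex (S k).
Proof.
move=> x y t t01 /= Sx Sy.
by have := econvex_epi (@f_convex k) t01 Sx Sy; rewrite !mulr0 addr0.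
Qed.

Let Ccvx n : convex (C n).
Proof. by move=> x y t t01 Cx Cy k nk; apply: Scvx => //; [exact: Cx|exact: Cy]. Qed.

Let Sball k x : (0 < k)%N -> (`|x - x0| < rho)%R -> S k x.
Proof. by move=> k0 xb; exact/ltW/f_ball. Qed.

Let x0_ball : (`|x0 - x0| < rho)%R. Proof. by rewrite subrr normr0. Qed.

Let Cx0 n : C n x0.
Proof. by move=> k nk; apply: Sball => //; exact: leq_ltn_trans nk. Qed.

Lemma affine_minorant_seq : exists (L : nat -> dual X) (B : nat -> R),
  [/\ forall x, (L 0%N x + B 0%N)%:E <= f 0%N x,
      forall n x, C n x -> (v <= L n x + B n)%R &
      forall n x, S n.+1 x -> (L n.+1 x + B n.+1 <= L n x + B n)%R].
Proof.
case f0E: (f 0%N x0) f0_x0 (@f_Noo 0 x0) => [g| |] // _ _.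
have [|||||x s fx Cx|l [b [lf lC]]] := @affine_sandwich _ _
    (fun x s => f 0%N x <= s%:E) (C 0%N) x0 g v rho.
- by move=> x y s r t t01; exact: econvex_epi.
- exact: Ccvx.
- exact: rho_gt0.
- by move=> x xb k k0; exact: Sball.
- by rewrite f0E.
- by rewrite -lee_fin; apply: le_trans fx; exact: f0_ge.
(* [C n] is the intersection of [C n.+1] and [S n.+1], so the splitting lemma applies. The bound on
   [p] is a premise under the existential so that [choice] gives a step defined on every pair. *)
have step (p : nat * (dual X * R)) : exists q : dual X * R,
    (forall x, C p.1 x -> (v <= p.2.1 x + p.2.2)%R) ->
    (forall x, C p.1.+1 x -> (v <= q.1 x + q.2)%R) /\
    (forall x, S p.1.+1 x -> (q.1 x + q.2 <= p.2.1 x + p.2.2)%R).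
  case: p => n [m c] /=.
  have [mC|nmC] := pselect (forall x, C n x -> (v <= m x + c)%R); last first.
    by exists (m, c).
  have [||x Cx Sx|m' [c' H]] := @affine_lower_bound_split _ _
    (C n.+1) (S n.+1) m c v rho x0 (@Ccvx _) (@Scvx _) rho_gt0.
  - exact: Cx0.
  - by move=> x; exact: Sball.
  - apply: mC => k; rewrite leq_eqVlt => /orP[/eqP <-//|]; exact: Cx.
  by exists (m', c').
have [g' g'P] := choice step.
pose A := nat_rect (fun=> (dual X * R)%type) (l, b) (fun n p => g' (n, p)).
have AC n x : C n x -> (v <= (A n).1 x + (A n).2)%R.
  elim: n x => [|n IH] x; first exact: lC.
  exact: (g'P (n, A n) IH).1.
exists (fun n => (A n).1), (fun n => (A n).2); split=> //.
  move=> x; case fE: (f 0%N x) (@f_Noo 0%N x) => [r| |] // _; last by rewrite leey.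
  by rewrite lee_fin; apply: lf; rewrite fE.
by move=> n x; exact: (g'P (n, A n) (AC n)).2.
Qed.

Lemma affine_minorant_limit : exists (l : dual X) (b : R),
  [/\ (z l + b)%:E <= biconjugate (f 0%N) z &
      forall x (F : R), (forall k, (0 < k)%N -> f k x <= F%:E) ->
        (v <= l x + b)%R].
Proof.
have [L [B [Lf LC LS]]] := affine_minorant_seq.
pose W n := (L n x0 + B n)%R.
have Wv n : (v <= W n)%R by exact: LC.
have [r /andP[r0 rrho]] : exists r : R, (0 < r < rho)%R.
  by exists (rho / 2)%R; rewrite divr_gt0//= ltr_pdivrMr// ltr_pMr// ltr1n.
(* The points [x0 + r *: y] and [x0 - r *: y] lie in the ball, hence in [S n.+1]. Comparing the two
   affine functions there bounds both signs of [(L n.+1 - L n) (r *: y)] by [W n - W n.+1]. *)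
have LW n : (`|L n.+1 - L n| <= W n / r - W n.+1 / r)%R.
  apply: dual_norm_le => y y1; rewrite -mulrBl ler_pdivlMr// mulrC.
  have rE : (r * `|(L n.+1 - L n)%R y| = `|(L n.+1 - L n)%R (r *: y)|)%R.
    by rewrite linearZ /= normrM gtr0_norm.
  have ball e : (`|e| = 1)%R -> (`|x0 + e *: (r *: y) - x0| < rho)%R.
    move=> e1; rewrite addrC addKr !normrZ e1 mul1r gtr0_norm//.
    by apply: le_lt_trans rrho; rewrite ler_piMr// ltW.
  have d e : (`|e| = 1)%R -> (e * (L n.+1 - L n)%R (r *: y) <= W n - W n.+1)%R.
    move=> /ball /(@Sball n.+1 _ isT) /LS.
    have dE u : ((L n.+1 - L n)%R u = L n.+1 u - L n u)%R by [].
    rewrite dE !linearD !linearZ /= /W.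
    rewrite /GRing.scale /=; lra.
  rewrite rE ler_norml; apply/andP; split.
    by have := d (-1)%R; rewrite normrN1 mulN1r => /(_ erefl); lra.
  by have := d 1%R; rewrite normr1 mul1r => /(_ erefl).
have Wvr n : (v / r <= W n / r)%R by rewrite ler_pM2r ?invr_gt0.
have [l Ll] := dual_cvg_of_variation LW Wvr.
have Wdec : nonincreasing_seq W.
  apply/nonincreasing_seqP => n; rewrite -subr_ge0.
  have := le_trans (normr_ge0 _) (LW n).
  by rewrite -mulrBl pmulr_lge0// invr_gt0.
have Wcvg : cvgn W by apply: nonincreasing_is_cvgn => //; exists v => _ [n _ <-].
have zL (y : dual (dual X)) : y (L n) @[n --> \oo] --> y l.
  by apply: continuous_cvg; [exact: dual_continuous|exact: Ll].
have LX x : L n x @[n --> \oo] --> l x.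
  have [y yx] := ex_evaluation x; rewrite -yx.
  by under eq_fun do rewrite -yx; exact: zL.
have Blim : B n @[n --> \oo] --> (limn W - l x0)%R.
  have -> : B = (fun n => W n - L n x0)%R.
    by apply/funext => n; rewrite /W addrAC subrr add0r.
  by apply: cvgB; [exact: Wcvg|exact: LX].
exists l, (limn W - l x0)%R; split.
  apply: le_trans (biconjugate_ge_affine z Lf); rewrite lee_fin.
  (* The inequality valid on [S n.+1] passes to the bidual, [x0] being a Slater point of
     [f n.+1]. *)
  have zdec n : (z (L n.+1) + B n.+1 <= z (L n) + B n)%R.
    have [m [c mc]] := ex_affine_minorant (@f_convex n.+1) (@f_Noo n.+1) rho_gt0
      (fun x xb => ltW (@f_ball n.+1 x isT xb)).
    have d x : f n.+1 x <= 0 -> ((L n.+1 - L n)%R x + (B n.+1 - B n) <= 0)%R.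
      move=> /LS; have -> : ((L n.+1 - L n)%R x = L n.+1 x - L n x)%R by [].
      lra.
    have := le0_sublevel_biconjugate (@f_convex n.+1) mc
      (@f_ball n.+1 x0 isT x0_ball) d (@fz n.+1 isT).
    by rewrite linearB /=; lra.
  have zle n : (z (L n) + B n <= z (L 0%N) + B 0%N)%R.
    by elim: n => // n; exact: le_trans.
  have zcvg : (z (L n) + B n)%R @[n --> \oo] --> (z l + (limn W - l x0))%R.
    exact: cvgD.
  by apply: (cvgr_to_le zcvg); apply: nearW.
move=> x F fF; set b := (limn W - l x0)%R.
have vt t : (0 < t <= 1)%R -> (v <= t * (l x0 + b) + (1 - t) * (l x + b))%R.
  move=> /andP[t0 t1]; pose y := (t *: x0 + (1 - t) *: x)%R.
  have -> : (t * (l x0 + b) + (1 - t) * (l x + b) = l y + b)%R.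
    by rewrite /y linearP linearZ /= /GRing.scale /=; ring.
  (* Past this [N], the weight [t] on [f k x0] contributes at most [- max F 0], which absorbs
     [(1 - t) * F]. *)
  have [N NM] := f_x0 (Num.max F 0 / t)%R.
  have Ny n : (N <= n)%N -> C n y.
    move=> Nn k nk; have Nk : (N < k)%N by exact: leq_ltn_trans nk.
    have t01 : (0 <= t <= 1)%R by rewrite ltW.
    have fk : f k x <= F%:E by apply: fF; exact: leq_ltn_trans Nk.
    apply: le_trans (econvex_epi (@f_convex k) t01 (NM _ Nk) fk) _.
    rewrite lee_fin mulrN mulrCA divff ?gt_eqF// mulr1.
    have : ((1 - t) * F <= (1 - t) * Num.max F 0)%R.
      by rewrite ler_wpM2l ?subr_ge0// le_max lexx.
    have : (0 <= t * Num.max F 0)%R by rewrite mulr_ge0 ?(ltW t0)// le_max lexx orbT.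
    lra.
  have ycvg : (L n y + B n)%R @[n --> \oo] --> (l y + b)%R by exact: cvgD.
  apply: (cvgr_to_ge ycvg).
  by exists N => // n Nn; apply: LC; exact: Ny.
rewrite leNgt; apply/negP => lxv.
have d0 : (0 < l x0 - l x)%R.
  by have := vt 1%R; rewrite ltr01 lexx => /(_ isT); lra.
pose q := (v - (l x + b))%R.
have q0 : (0 < q)%R by rewrite subr_gt0.
have qd : (q <= l x0 - l x)%R.
  by have := vt 1%R; rewrite ltr01 lexx /q => /(_ isT); lra.
(* For this weight the average in [vt] equals [v - q / 2], a contradiction. *)
have t01 : (0 < q / (2 * (l x0 - l x)) <= 1)%R.
  by rewrite divr_gt0 ?mulr_gt0//= ler_pdivrMr ?mulr_gt0//; lra.
have := vt _ t01; set t := (q / _)%R.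
have : (t * (l x0 - l x) = q / 2)%R by rewrite /t; field; rewrite gt_eqF.
by rewrite /q; lra.
Qed.

Lemma biconjugate_ge_countable_inf
    (fsup := fun x => ereal_sup [set f k x | k in [set k | (1 <= k)%N]]) :
  weak_star_closure (edom (biconjugate fsup)) z ->
  v%:E <= biconjugate (f 0%N) z.
Proof.
move=> zcl; have [l [b [lz lv]]] := affine_minorant_limit.
apply: le_trans lz; rewrite lee_fin.
(* An affine minorant of [f 1] also minorizes [fsup], as [le0_edom_biconjugate] requires. *)
have [m [c mc]] := ex_affine_minorant (@f_convex 1%N) (@f_Noo 1%N) rho_gt0
  (fun x xb => ltW (@f_ball 1%N x isT xb)).
have fle k x : (0 < k)%N -> f k x <= fsup x.
  by move=> k0; apply: ereal_sup_ubound; exists k.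
have lD x : edom fsup x -> (v <= l x + b)%R.
  rewrite /edom /=; case fxE: (fsup x) => [F| |] // _.
    by apply: (lv _ F) => k k0; rewrite -fxE; exact: fle.
  by apply: (lv _ 0%R) => k k0; rewrite (le_trans (fle k x k0))// fxE leNye.
have yD y : edom (biconjugate fsup) y -> (v <= y l + b)%R.
  move=> yoo; have mfsup x : (m x + c)%:E <= fsup x.
    by apply: le_trans (mc x) _; exact: fle.
  have d x : edom fsup x -> ((- l)%R x + (v - b) <= 0)%R.
    by move=> /lD; have -> : ((- l)%R x = - l x)%R by []; lra.
  by have := le0_edom_biconjugate mfsup d yoo; rewrite linearN /=; lra.
rewrite leNgt; apply/negP => zv.
(* Evaluation at [l] is weak-star continuous, so a violation at [z] would persist at some point of
   the domain. *)
have zl : (y : dual (dual X)) l @[y --> nbhs (z : weak_star (dual X))] --> z l.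
  by have /weak_star_cvgP := @cvg_id _ (nbhs (z : weak_star (dual X))); exact.
have lt : (z l < v - b)%R by rewrite ltrBrDr.
have /zcl [y [Dy /=]] : nbhs (z : weak_star (dual X))
    [set y : dual (dual X) | (y l < v - b)%R].
  exact: (cvgr_lt _ zl).
by have := yD _ Dy; lra.
Qed.

End countable_constraints.

(** * Consequences of the reinforced Slater condition *)

Lemma summable_cvg0 {R : realType} (a : nat -> R) :
  \sum_(1 <= k <oo) `|a k|%:E < +oo -> a k @[k --> \oo] --> 0%R.
Proof.
move=> aoo; rewrite -cvg_shiftS; apply: cvg_series_cvg_0.
apply: normed_cvg.
apply: nondecreasing_is_cvgn.
  by apply: nondecreasing_series => n _ _; exact: normr_ge0.
exists (fine (\sum_(1 <= k <oo) `|a k|%:E)) => _ [n _ <-].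
have sum_ge0 : 0 <= \sum_(1 <= k <oo) `|a k|%:E.
  by apply: nneseries_ge0 => k _ _; rewrite lee_fin.
rewrite -lee_fin fineK ?ge0_fin_numE//.
apply: le_trans (nneseries_lim_ge n.+1 _).
  by rewrite /series /= sumEFin lee_fin big_add1.
by move=> k _ _; rewrite lee_fin.
Qed.

(** At [t *: u + (1 - t) *: x1] with [u] near [x2], convexity bounds [f k] by
    [t * K - (1 - t) * c / alpha k]. As [alpha] is bounded, a small [t] makes this negative
    uniformly in [k]; as [alpha] tends to [0], it tends to [-oo]. *)
Lemma ex_slater_ball {R : realType} {X : normedModType R}
    (f : nat -> X -> \bar R) (x1 x2 : X) (c K r : R) (alpha : nat -> R) :
  (forall k, econvex (f k)) -> (0 < c)%R -> (0 < r)%R ->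
  (forall k, (0 < k)%N -> (0 < alpha k)%R) -> alpha k @[k --> \oo] --> 0%R ->
  (forall k, (0 < k)%N -> f k x1 <= (- (c / alpha k))%:E) ->
  (forall k x, (0 < k)%N -> (`|x - x2| < r)%R -> f k x <= K%:E) ->
  f 0%N x1 < +oo -> f 0%N x2 < +oo -> (forall k x, f k x != -oo) ->
  exists x0 rho, [/\ (0 < rho)%R, f 0%N x0 < +oo,
    forall k x, (0 < k)%N -> (`|x - x0| < rho)%R -> f k x < 0 &
    forall M : R, exists N, forall k, (N < k)%N -> f k x0 <= (- M)%:E].
Proof.
move=> fcvx c0 r0 a0 acvg fx1 fx2 f0x1 f0x2 fNoo.
have [A [A0 aA]] : exists A : R, (0 < A)%R /\ forall k, (0 < k)%N -> (alpha k <= A)%R.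
  have /cvg_seq_bounded/pinfty_ex_gt0[A A0 HA] : cvgn alpha by apply/cvg_ex; exists 0%R.
  by exists A; split=> // k _; exact: le_trans (ler_norm _) (HA k I).
pose K' := Num.max K 0%R; pose e := (c / A)%R.
have e0 : (0 < e)%R by exact: divr_gt0.
have K'0 : (0 <= K')%R by rewrite le_max lexx orbT.
have KK' : (K <= K')%R by rewrite le_max lexx.
(* Chosen so that [t * K' - (1 - t) * e = - e / 2]. *)
pose t := (e / (2 * (K' + e)))%R.
have Ke0 : (0 < K' + e)%R by exact: ltr_wpDl.
have t0 : (0 < t)%R by rewrite divr_gt0// mulr_gt0.
have t1 : (t < 1)%R by rewrite ltr_pdivrMr ?mulr_gt0//; lra.
have tE : (t * (K' + e) = e / 2)%R by rewrite /t; field; rewrite gt_eqF.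
have t01 : (0 <= t <= 1)%R by rewrite !ltW.
clearbody t.
have fk k u : (0 < k)%N -> (`|u - x2| < r)%R ->
    f k (t *: u + (1 - t) *: x1)%R <= (t * K' - (1 - t) * (c / alpha k))%:E.
  move=> k0 ur; rewrite -mulrN; apply: econvex_epi => //; last exact: fx1.
  by apply: le_trans (fx2 _ _ k0 ur) _; rewrite lee_fin.
exists (t *: x2 + (1 - t) *: x1)%R, (t * r)%R; split.
- exact: mulr_gt0.
- have := fcvx 0%N x2 x1 t t01; case: (f 0%N x2) (fNoo 0%N x2) f0x2 => // s _ _.
  case: (f 0%N x1) (fNoo 0%N x1) f0x1 => // s' _ _; move=> /le_lt_trans; apply.
  by rewrite -!EFinM -EFinD ltry.
- move=> k x k0 xr.
  pose u := (x2 + t^-1 *: (x - (t *: x2 + (1 - t) *: x1)))%R.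
  have -> : (x = t *: u + (1 - t) *: x1)%R.
    rewrite /u scalerDr scalerA divff ?gt_eqF// scale1r.
    by rewrite addrAC addrC subrK.
  apply: le_lt_trans (fk k u k0 _) _.
    rewrite /u addrAC subrr add0r normrZ gtr0_norm ?invr_gt0//.
    by rewrite ltr_pdivrMl.
  have ea : (e <= c / alpha k)%R by rewrite ler_pM2l// lef_pV2 ?posrE ?a0// aA.
  have : ((1 - t) * e <= (1 - t) * (c / alpha k))%R by rewrite ler_wpM2l// subr_ge0 ltW.
  by rewrite lte_fin; lra.
- move=> M; pose d := ((1 - t) * c / (`|M| + 1 + t * K'))%R.
  have M0 : (0 < `|M| + 1 + t * K')%R.
    have tK0 : (0 <= t * K')%R by rewrite mulr_ge0// ltW.
    by have := normr_ge0 M; lra.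
  have d0 : (0 < d)%R by rewrite divr_gt0// mulr_gt0// subr_gt0.
  have [N _ HN] := cvgr_lt _ acvg _ d0.
  exists N => k Nk; have k0 : (0 < k)%N by exact: leq_ltn_trans Nk.
  apply: le_trans (fk k x2 k0 _) _; first by rewrite subrr normr0.
  have ad : (alpha k < d)%R by apply: HN => /=; exact: ltnW.
  have : (`|M| + 1 + t * K' <= (1 - t) * (c / alpha k))%R.
    rewrite mulrA ler_pdivlMr ?a0// mulrC -ler_pdivlMr//.
    exact: ltW.
  by have := ler_norm M; rewrite lee_fin; lra.
Qed.

(** * Equality of the optimal values *)

Theorem corollary8 (R : realType) (X : completeNormedModType R)
    (f : nat -> X -> \bar R)
    (f_proper : forall k : nat, eproper (f k))
    (f_convex : forall k : nat, econvex (f k))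
    (fsup := fun x : X => ereal_sup [set f k x | k in [set k | (1 <= k)%N]])
    (vP := optval (f 0%N) [set x | forall k, (1 <= k)%N -> f k x <= 0])
    (vP3 := optval (biconjugate (f 0%N))
       [set z | (forall k, (1 <= k)%N -> biconjugate (f k) z <= 0) /\
                weak_star_closure (edom (biconjugate fsup)) z])
    (vP_lty : vP < +oo)
    (slater : exists (x0 : X) (alpha : nat -> R),
       [/\ edom (f 0%N) x0,
           \sum_(1 <= k <oo) `|alpha k|%:E < +oo,
           forall k, (1 <= k)%N -> (0 < alpha k)%R &
           ereal_sup [set (alpha k)%:E * f k x0 | k in [set k | (1 <= k)%N]]
             < 0])
    (fsup_cont : exists x : X,
       [/\ edom (f 0%N) x, fsup x \is a fin_num & {for x, continuous fsup}]) :
  vP3 = vP.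
Proof.
have f_Noo k x : f k x != -oo by exact: (f_proper k).1.
have fle k x : (0 < k)%N -> f k x <= fsup x.
  by move=> k0; apply: ereal_sup_ubound; exists k.
apply/eqP; rewrite eq_le; apply/andP; split.
  (* Easy inequality: the canonical image of a feasible [x] is feasible in the bidual, with no
     larger objective value. *)
  apply: le_ereal_inf_tmp => _ [x fx <-].
  have [z zx] := ex_evaluation x.
  apply: le_trans (biconjugate_evaluation_le (f 0%N) zx).
  apply: ereal_inf_lbound; exists z => //; split.
    by move=> k k0; exact: le_trans (biconjugate_evaluation_le (f k) zx) (fx k k0).
  apply: subset_closure; rewrite /edom /=.
  apply: le_lt_trans (biconjugate_evaluation_le fsup zx) _.
  apply: (@le_lt_trans _ _ 0); last exact: ltry.
  by apply: ge_ereal_sup => _ [k k0 <-]; exact: fx.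
case: slater => x1 [alpha [f0x1 alpha_sum alpha0 fx1]].
case: fsup_cont => x2 [f0x2 fx2_fin fx2_cont].
have acvg := summable_cvg0 alpha_sum.
have [c c0 fx1c] : exists2 c : R, (0 < c)%R &
    forall k, (0 < k)%N -> f k x1 <= (- (c / alpha k))%:E.
  have [c c0 supc] : exists2 c : R, (0 < c)%R & ereal_sup
      [set (alpha k)%:E * f k x1 | k in [set k | (1 <= k)%N]] <= (- c)%:E.
    (* If the supremum is [-oo], any positive [c] will do. *)
    case: ereal_sup fx1 => [s| |] //; last by exists 1%R; rewrite ?leNye.
    by rewrite lte_fin => s0; exists (- s)%R; rewrite ?oppr_gt0// opprK.
  exists c => // k k0.
  have : (alpha k)%:E * f k x1 <= (- c)%:E.
    by apply: le_trans supc; apply: ereal_sup_ubound; exists k.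
  case: (f k x1) (f_Noo k x1) => [s| |] // _; last first.
    by rewrite gt0_muley ?lte_fin ?alpha0.
  by rewrite -EFinM !lee_fin -mulNr ler_pdivlMr ?alpha0// mulrC.
(* Continuity of [fsup] at [x2] bounds all [f k], [k >= 1], on one ball by one constant. *)
have [K [r r0 fx2K]] : exists K : R, exists2 r : R, (0 < r)%R &
    forall x, (`|x - x2| < r)%R -> fsup x <= K%:E.
  exists (fine (fsup x2) + 1)%R.
  have /fx2_cont/nbhs_normP[r /= r0 rK] :
      nbhs (fsup x2) [set y : \bar R | y < (fine (fsup x2) + 1)%:E].
    apply: open_nbhs_nbhs; split; first exact: open_ereal_lt_ereal.
    by rewrite /= EFinD fineK// lteDl// lte01.
  exists r => // x xr.
  by apply/ltW/rK; rewrite /ball_ /= distrC.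
have [x0 [rho [rho0 f0x0 fball fx0]]] := ex_slater_ball f_convex c0 r0 alpha0 acvg
  fx1c (fun k x k0 xr => le_trans (fle k x k0) (fx2K x xr)) f0x1 f0x2 f_Noo.
apply: le_ereal_inf_tmp => _ [z [fz zcl] <-].
have vP_le x : (forall k, (0 < k)%N -> f k x <= 0) -> vP <= f 0%N x.
  by move=> fx; apply: ereal_inf_lbound; exists x.
case: vP vP_lty vP_le => [v| |] // _ vP_le; last by rewrite leNye.
exact: biconjugate_ge_countable_inf f_Noo f_convex rho0 f0x0 fball fx0 vP_le fz zcl.
Qed.
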